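(* Let $G$ be a locally compact, second countable, $\sigma$-compact Abelian group which is not compact. Let $\mu,\nu$ be discrete almost periodic translation bounded measures on $G$ with supports $\Lambda=\operatorname{supp}\mu$ and $\Gamma=\operatorname{supp}\nu$. Suppose that there are decompositions, indexed by a common set $A$, $$\Lambda=\bigcup_{\alpha\in A}\Lambda_\alpha,\qquad \Gamma=\bigcup_{\alpha\in A}\Gamma_\alpha,\qquad \Lambda_\alpha\cap\Lambda_{\alpha'}=\emptyset,\quad \Gamma_\alpha\cap\Gamma_{\alpha'}=\emptyset\quad\text{for all }\alpha\neq\alpha',$$ such that: (1) for some neighborhood $U$ of $0$, $$\sup_{x\in G}\#\{\alpha\in A:\ (x+U)\cap(\Lambda_\alpha\cup\Gamma_\alpha)\neq\emptyset\}<\infty;$$ (2) for every neighborhood $V$ of $0$ and every $\varepsilon>0$ there is a compact set $K\subset G$ such that for every $\alpha\in A$ with $(\Lambda_\alpha\cup\Gamma_\alpha)\cap K=\emptyset$ one has $$\Lambda_\alpha\cup\Gamma_\alpha\subset x+V\ \text{ for all } x\in\Lambda_\alpha\cup\Gamma_\alpha,\qquad\text{and}\qquad |\mu(\Lambda_\alpha)-\nu(\Gamma_\alpha)|<\varepsilon.$$ Then $\mu=\nu$.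
   Context: $G$ is written additively. $C_u(G)$ is the space of uniformly continuous bounded complex functions on $G$ with the sup-norm, and $C_c(G)$ is its subspace of compactly supported continuous functions. $\#$ denotes the number of elements of a set. A Radon measure on $G$ is a complex-valued $\sigma$-additive set function $\mu$, defined on relatively compact Borel sets, whose variation $|\mu|$ is finite on every compact set and which is inner regular: for every $\varepsilon>0$ and every relatively compact Borel set $A$ there is a compact $K_\varepsilon\subset A$ with $|\mu|(A\setminus K_\varepsilon)<\varepsilon$. All measures are Radon measures in this sense. Such a measure need not have finite total variation. A measure $\mu$ on $G$ with support $\Lambda$ is discrete if each $\lambda\in\Lambda$ has a neighborhood $\lambda+U$ with $(\lambda+U)\cap\Lambda=\{\lambda\}$; then one writes $\mu=\sum_{\lambda\in\Lambda}\mu(\lambda)\delta_\lambda$ with $\mu(\lambda)\in\mathbb{C}$, where $\delta_\lambda$ is the unit mass at $\lambda$. Accordingly $\mu(\Lambda_\alpha)=\sum_{\lambda\in\Lambda_\alpha}\mu(\lambda)$ and $\nu(\Gamma_\alpha)=\sum_{\gamma\in\Gamma_\alpha}\nu(\gamma)$ (finite sums when the sets are relatively compact). $\mu$ is translation bounded if $\sup_{t\in G}|\mu|(K+t)<\infty$ for every compact $K\subset G$. A function $g\in C_u(G)$ is almost periodic if the closure of the family of translates $\{g(\cdot-t)\}_{t\in G}$ is a compact subset of $C_u(G)$. A Radon measure $\mu$ on $G$ is almost periodic if for each $f\in C_c(G)$ the function $(f\star\mu)(x)=\int f(x-y)\,d\mu(y)$ is almost periodic on $G$.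
   Formalization: Added hypothesis: for every α the sums defining μ(Λ_α) and ν(Γ_α) converge absolutely; without it the claim fails, e.g. G=ℝ, μ=δ_ℤ, ν=2δ_ℤ, A one point, Λ_α=Γ_α=ℤ, where (2) is vacuous with K={0}. *)

(* Defs.v *)
From HB Require Import structures.
From mathcomp Require Import all_boot all_order all_algebra.
From mathcomp Require Import all_classical all_reals all_analysis.
From mathcomp.real_closed Require Import complex.
From mathcomp.analysis.showcase Require Import summability.

Set Implicit Arguments.
Unset Strict Implicit.
Unset Printing Implicit Defensive.

Import Order.TTheory GRing.Theory Num.Theory ComplexField.Normc.
Import numFieldNormedType.Exports.

Local Open Scope classical_set_scope.
Local Open Scope ring_scope.

(* The library only puts a topology on [R[i]^o]; this makes it available on
   [R[i]] itself.  Norms and radii are [R[i]]-valued there; [normc] is the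
   modulus as an element of [R]. *)
HB.instance Definition _ (R : realType) := NormedModule.copy R[i] R[i]^o.

Definition sigma_compact (T : topologicalType) :=
  exists2 K : nat -> set T, forall n, compact (K n) & \bigcup_n K n = setT.

(* [g_sigma_algebraType] wants a pointed carrier. *)
Definition pointed_at0 (G : topologicalZmodType) : Type := G.

HB.instance Definition _ (G : topologicalZmodType) :=
  Choice.copy (pointed_at0 G) G.
HB.instance Definition _ (G : topologicalZmodType) :=
  isPointed.Build (pointed_at0 G) (0 : G).

Notation borelType G :=
  (g_sigma_algebraType (@open G : set (set (pointed_at0 G)))).

Section RadonMeasures.
Context {R : realType} {G : topologicalZmodType}.
Implicit Types (mu : set G -> R[i]) (s : set G -> R) (A B K L : set G).

(* Set functions below are total, but only their values on [rc_borel] sets are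
   ever used. *)
Definition rc_borel : set (set G) := [set A | <<s @open G >> A /\ precompact A].

(* For an arbitrary Borel set [A] this is the supremum over all finite
   disjoint families of relatively compact Borel subsets of [A], hence the
   (possibly infinite) value at [A] of the positive measure |mu|. *)
Definition radon_variation mu A : \bar R :=
  ereal_sup [set v | exists n (F : nat -> set G),
    [/\ forall i, (i < n)%N -> rc_borel (F i),
        trivIset `I_n F,
        \bigcup_(i in `I_n) F i `<=` A &
        v = (\sum_(i < n) normc (mu (F i)))%:E]].

Definition csigma_additive mu :=
  forall A (F : nat -> set G), rc_borel A ->
    (forall n, rc_borel (F n)) -> trivIset setT F -> \bigcup_n F n = A ->
    (fun n => \sum_(i < n) mu (F i)) @ \oo --> mu A.

Definition inner_regular mu :=
  forall (e : R) A, 0 < e -> rc_borel A ->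
    exists K, [/\ compact K, K `<=` A & (radon_variation mu (A `\` K) < e%:E)%E].

Definition msupport mu : set G :=
  [set x | forall U, open_nbhs x U -> (0 < radon_variation mu U)%E].

Definition discrete_measure mu :=
  forall x, msupport mu x -> exists2 U : set G,
    nbhs (0 : G) U & [set x + u | u in U] `&` msupport mu = [set x].

Definition translation_bounded mu :=
  forall K, compact K ->
    (ereal_sup [set radon_variation mu [set (k + t)%R | k in K] | t in [set: G]]
       < +oo)%E.

(* Jordan decomposition: for a signed Radon measure [s], [upper_variation s]
   and [upper_variation (- s)] are the positive Borel measures s+ and s-. *)
Definition upper_variation s : set (borelType G) -> \bar R :=
  fun A => ereal_sup [set (s B)%:E | B in [set B | rc_borel B /\ B `<=` A]].

Definition signed_integral s (g : G -> R) : R :=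
  fine (\int[upper_variation s]_(y in [set: borelType G]) (g y)%:E)
  - fine (\int[upper_variation (fun A => - s A)]_(y in [set: borelType G])
            (g y)%:E).

Definition complex_integral mu (f : G -> R[i]) : R[i] :=
  Complex
    (signed_integral (fun A => complex.Re (mu A)) (fun y => complex.Re (f y))
     - signed_integral (fun A => complex.Im (mu A)) (fun y => complex.Im (f y)))
    (signed_integral (fun A => complex.Re (mu A)) (fun y => complex.Im (f y))
     + signed_integral (fun A => complex.Im (mu A)) (fun y => complex.Re (f y))).

Definition convolution (f : G -> R[i]) mu : G -> R[i] :=
  fun x => complex_integral mu (fun y => f (x - y)).

Definition Cc : set (G -> R[i]) :=
  [set f | continuous f /\ compact (closure [set x | f x != 0])].

Definition Cu : set {uniform G -> R[i]} :=
  [set g | (exists M : R, forall x, normc (g x) <= M) /\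
    (forall e : R, 0 < e ->
       \forall u \near (0 : G), forall x, normc (g (x + u) - g x) < e)].

(* The sup-norm topology of [Cu] is the one induced by [{uniform G -> R[i]}], so
   the closure in [Cu] is the trace on [Cu] of the ambient closure. *)
Definition almost_periodic_fun (g : G -> R[i]) :=
  Cu g /\
  compact (closure [set ((fun x => g (x - t)) : {uniform G -> R[i]})
                   | t in [set: G]] `&` Cu).

Definition almost_periodic mu :=
  forall f, Cc f -> almost_periodic_fun (convolution f mu).

Definition abs_summable mu L : Prop :=
  (\esum_(x in L) (normc (mu [set x]))%:E < +oo)%E.

(* The total mass of the atoms in [L]: limit of the net of finite partial sums,
   a finite sum when only finitely many points of [L] carry mass. *)
Definition mass mu L : R[i] :=
  sum (fun x : G => if x \in L then mu [set x] else 0).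

End RadonMeasures.

Record radon_measure (R : realType) (G : topologicalZmodType) := RadonMeasure {
  radon_fun :> set G -> R[i];
  radon_sigma_additive : csigma_additive radon_fun;
  radon_locally_finite :
    forall K, compact K -> (radon_variation radon_fun K < +oo)%E;
  radon_inner_regular : inner_regular radon_fun }.

(* Main.v *)
From HB Require Import structures.
Require Import Defs.
From mathcomp Require Import all_boot all_order all_algebra.
From mathcomp Require Import all_classical all_reals all_analysis.
From mathcomp Require Import measurable_realfun.
From mathcomp.analysis.showcase Require Import summability.
From mathcomp.real_closed Require Import complex.
From mathcomp Require Import ring lra.
Import Order.TTheory GRing.Theory Num.Theory ComplexField.Normc.
Import numFieldNormedType.Exports.
Local Open Scope classical_set_scope.
Local Open Scope ring_scope.
Set Implicit Arguments.
Unset Strict Implicit.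
Unset Printing Implicit Defensive.

(** The two measures are compared through their convolutions with bump
    functions [phi].  Put [g = phi * mu - phi * nu].

    [g] vanishes at infinity.  Group the atoms seen by [phi (x - _)] according
    to the index [a] of the sets [Lambda a] and [Gamma a] they belong to: if the
    support of [phi] is small, at most [N] indices occur, with [N] independent
    of [x].  The indices whose sets meet the compact set [K] of the hypothesis
    are finitely many, and each contributes little once [x] is far away, as its
    atoms are summable.  For any other index the set
    [Lambda a `|` Gamma a] is so small that [phi (x - _)] is nearly constant on
    it, so that its contribution is nearly that constant times
    [mass mu (Lambda a) - mass nu (Gamma a)], which is small as well; the error
    is controlled by translation boundedness ([far_block],
    [blocks_at_infinity], [convolution_difference_at_infinity]).

    An almost periodic function that vanishes at infinity is zero, because it
    comes back close to each of its values outside of every compact set, and [G]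
    is not compact.  Hence [phi * mu = phi * nu] ([almost_periodic_eq]).

    For [phi] with [phi 0 = 1] and with a support so small that [x] is the only
    possible atom in [x - supp phi], the values of the two convolutions at [x]
    are the masses of [x] ([convolution_isolated]), so [mu] and [nu] have the
    same atoms, and a discrete Radon measure is determined by its atoms
    ([radon_atomic]).

    What makes this work with the integral of the definitions is that the upper
    variation of a discrete measure is, on arbitrary sets, the sum of the
    positive parts of the atoms ([upper_variationE]); convolutions are then
    finite sums ([convolution_atoms], [atom_conv_seq]). *)

(** * The modulus of complex numbers *)

Section ComplexModulus.
Context {R : realType}.
Implicit Types z w : R[i].

Lemma normc_norm z : (normc z)%:C%C = `|z|. Proof. by []. Qed.

Lemma normc_ge0 z : 0 <= normc z.
Proof. by case: z => a b; exact: sqrtr_ge0. Qed.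

(** [le_normcD] speaks of the sum of [Rcomplex R], which rewriting does not
    identify with the sum of [R[i]]. *)
Lemma normcD z w : normc (z + w) <= normc z + normc w.
Proof. exact: le_normcD. Qed.

Lemma normc_sum (I : Type) (r : seq I) (P : pred I) (F : I -> R[i]) :
  normc (\sum_(i <- r | P i) F i) <= \sum_(i <- r | P i) normc (F i).
Proof.
elim/big_ind2 : _ => [|x1 x2 y1 y2 h1 h2|//]; first by rewrite normc0.
by apply: le_trans (normcD _ _) _; exact: lerD.
Qed.

Lemma normcB z w : normc (z - w) = normc (w - z).
Proof. by rewrite -opprB normcN. Qed.

Lemma normc_real (x : R) : normc x%:C%C = `|x|.
Proof. by rewrite /= expr0n /= addr0 sqrtr_sqr. Qed.

(** Radii of balls in [R[i]] are positive elements of [R[i]], hence real. *)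
Lemma nbhs_normcP z (P : set R[i]) :
  nbhs z P <-> exists2 e : R, 0 < e & forall w, normc (z - w) < e -> P w.
Proof.
split.
  move=> /nbhs_normP [e /= e0 eP].
  have eE : (complex.Re e)%:C%C = e.
    by rewrite (RRe_real (gtr0_real e0)).
  exists (complex.Re e); first by rewrite -ltcR eE.
  by move=> w zw; apply: eP => /=; rewrite -normc_norm -eE ltcR.
move=> [e e0 eP]; apply/nbhs_normP; exists e%:C%C; first by rewrite /= ltcR.
by move=> w /=; rewrite -normc_norm ltcR; exact: eP.
Qed.

Lemma entourage_normc (e : R) : 0 < e ->
  entourage [set zw : R[i] * R[i] | normc (zw.1 - zw.2) < e].
Proof.
move=> e0; rewrite -entourage_ballE; exists e%:C%C; first by rewrite /= ltcR.
by move=> [z w] /=; rewrite -ball_normE /= -normc_norm ltcR.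
Qed.

End ComplexModulus.

(** * Compact sets and translations *)

Section CompactInduction.
Context {T : topologicalType}.

(** The sets [A] such that [P] holds on [K `\` A] form a filter, which is proper
    when [P K] fails; a cluster point of it in [K] contradicts the local
    hypothesis. *)
Lemma compact_induction (P : set T -> Prop) (K : set T) :
  P set0 -> (forall A B, B `<=` A -> P A -> P B) ->
  (forall A B, P A -> P B -> P (A `|` B)) ->
  (forall x, K x -> exists2 U, nbhs x U & P U) ->
  compact K -> P K.
Proof.
move=> P0 Psub PU Ploc cK; apply: contrapT => nPK.
pose F : set_system T := [set A | P (K `\` A)].
have FF : ProperFilter F.
  apply: Build_ProperFilter_ex.
    move=> A PA; apply: contrapT => A0; apply: nPK.
    apply: Psub PA => x Kx; split=> // Ax; apply: A0; by exists x.
  split; first by rewrite /F /= setDT.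
    by move=> A B PA PB; rewrite /F /= setDIr; exact: PU.
  move=> A B AB; apply: Psub => x [Kx nBx]; split=> //; by move/AB.
have [|x [Kx clx]] := cK F FF; first by rewrite /F /= setDv.
have [U Ux PUx] := Ploc x Kx.
have [|y [nUy Uy]] := clx (~` U) U _ Ux; last exact: nUy.
by rewrite /F /=; apply: Psub PUx => y [_ /contrapT].
Qed.

End CompactInduction.

Section Translations.
Context {G : topologicalZmodType}.
Implicit Types (x : G) (K U : set G).

Lemma continuous_translate x : continuous (fun y : G => y + x).
Proof.
move=> y; apply: (@continuous_comp _ _ _ (fun y => (y, x)) (fun z => z.1 + z.2)).
  by apply: cvg_pair => //; exact: cvg_cst.
exact: add_continuous.
Qed.

Lemma continuous_reflect x : continuous (fun y : G => x - y).
Proof.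
move=> y; apply: (@continuous_comp _ _ _ (fun y => (x, y)) (fun z => z.1 - z.2)).
  by apply: cvg_pair => //; exact: cvg_cst.
exact: sub_continuous.
Qed.

Lemma compact_translate x K : compact K -> compact [set y + x | y in K].
Proof.
move=> cK; apply: continuous_compact => //; apply: continuous_subspaceT.
exact: continuous_translate.
Qed.

Lemma compact_reflect x K : compact K -> compact [set x - y | y in K].
Proof.
move=> cK; apply: continuous_compact => //; apply: continuous_subspaceT.
exact: continuous_reflect.
Qed.

Lemma nbhs_translate x U : nbhs 0 U -> nbhs x [set x + u | u in U].
Proof.
move=> U0; have cx := @continuous_translate (- x) x.
rewrite /continuous_at subrr in cx.
have h : nbhs x [set y | U (y - x)] by exact: (cx _ U0).
by apply: filterS h => y /= Uy; exists (y - x) => //; rewrite addrC subrK.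
Qed.

Lemma nbhs_opp0 U : nbhs 0 U -> nbhs 0 [set v | U (- v)].
Proof.
move=> U0; have := @opp_continuous G 0.
by rewrite /continuous_at oppr0 => /(_ _ U0).
Qed.

End Translations.

(** * Relatively compact Borel sets *)

Section Borel.
Context {G : topologicalZmodType}.
Implicit Types A B K : set G.

Lemma borel_measurable A : <<s @open G >> A = measurable (A : set (borelType G)).
Proof. by []. Qed.

Lemma borel_open A : open A -> <<s @open G >> A.
Proof. exact: sub_sigma_algebra. Qed.

Lemma borel_closed A : closed A -> <<s @open G >> A.
Proof.
move=> cA; rewrite borel_measurable -(setCK A).
by apply: measurableC; apply: borel_open; exact: closed_openC.
Qed.

Lemma rc_borel_sub A B : rc_borel A -> <<s @open G >> B -> B `<=` A ->
  rc_borel B.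
Proof. by move=> [_ pA] bB BA; split=> //; exact: precompact_subset pA. Qed.

Lemma rc_borel0 : rc_borel (set0 : set G).
Proof.
split; first by rewrite borel_measurable.
rewrite precompactE closure0; exact: compact0.
Qed.

Lemma rc_borelD A B : rc_borel A -> <<s @open G >> B -> rc_borel (A `\` B).
Proof.
move=> rA bB; apply: (rc_borel_sub rA) => [|x []//].
by case: rA => bA _; rewrite borel_measurable; apply: measurableD.
Qed.

Lemma rc_borelI A B : rc_borel A -> <<s @open G >> B -> rc_borel (A `&` B).
Proof.
move=> rA bB; apply: (rc_borel_sub rA) => [|x []//].
by case: rA => bA _; rewrite borel_measurable; apply: measurableI.
Qed.

Lemma rc_borelU A B : rc_borel A -> rc_borel B -> rc_borel (A `|` B).
Proof.
move=> [bA pA] [bB pB]; split.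
  by rewrite borel_measurable; apply: measurableU.
by rewrite precompactE closureU; apply: compactU; rewrite -precompactE.
Qed.

Hypothesis G_hausdorff : hausdorff_space G.

Lemma rc_borel_compact K : compact K -> rc_borel K.
Proof.
move=> cK; split; last exact: compact_precompact.
by apply: borel_closed; exact: compact_closed.
Qed.

Lemma rc_borel_finite A : finite_set A -> rc_borel A.
Proof. by move=> fA; apply: rc_borel_compact; exact: finite_compact. Qed.

Lemma rc_borel1 x : rc_borel [set x : G].
Proof. exact/rc_borel_finite/finite_set1. Qed.

End Borel.

(** * Radon measures and their atoms *)

Section RadonSupport.
Context {R : realType} {G : topologicalZmodType}.
Hypothesis G_hausdorff : hausdorff_space G.
Variable mu : radon_measure R G.
Implicit Types A B K : set G.

(** The constant sequence of empty sets is disjoint, so that [n * mu set0] tends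
    to [mu set0]. *)
Lemma radon0 : mu set0 = 0.
Proof.
have h : (fun n => \sum_(i < n) mu set0) @ \oo --> mu set0.
  apply: (@radon_sigma_additive _ _ mu set0 (fun=> set0)).
  - exact: rc_borel0.
  - by move=> _; exact: rc_borel0.
  - by move=> i j _ _ [x []].
  - by rewrite bigcup0.
have h1 : (fun n => \sum_(i < n.+1) mu set0) @ \oo --> mu set0.
  by rewrite -(cvg_shiftS (fun n => \sum_(i < n) mu set0)) in h.
have h2 := cvgB h1 h; rewrite subrr in h2.
have E : (fun n => \sum_(i < n.+1) mu set0) - (fun n => \sum_(i < n) mu set0) =
    (fun n : nat => mu set0).
  apply/funext => n; rewrite -[LHS]/(\sum_(i < n.+1) mu set0 - \sum_(i < n) mu set0).
  by rewrite big_ord_recr /= addrAC subrr add0r.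
rewrite E in h2.
have h3 : (fun n : nat => mu set0) @ \oo --> mu set0 by exact: cvg_cst.
exact: (@cvg_unique R[i] (@norm_hausdorff _ R[i]) _ _ _ _ h3 (h2 _)).
Qed.

Lemma radonU A B : rc_borel A -> rc_borel B -> A `&` B = set0 ->
  mu (A `|` B) = mu A + mu B.
Proof.
move=> rA rB AB0.
have h : (fun n => \sum_(i < n) mu (bigcup2 A B i)) @ \oo --> mu (A `|` B).
  apply: radon_sigma_additive.
  - exact: rc_borelU.
  - by move=> [|[|n]]; rewrite /bigcup2 //=; exact: rc_borel0.
  - by rewrite -trivIset_bigcup2.
  - exact: bigcup2E.
apply/esym; apply: (@cvg_unique R[i] (@norm_hausdorff _ R[i]) _ _ _ _ _ h).
apply: cvg_near_cst; near=> n.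
have n2 : (2 <= n)%N by near: n; exact: nbhs_infty_ge.
rewrite -(subnKC n2) big_split_ord /= !big_ord_recl big_ord0 /= addr0.
rewrite [X in _ + X]big1 ?addr0// => i _.
by rewrite /bigcup2 /= radon0.
Unshelve. all: by end_near. Qed.

Lemma radonD A B : rc_borel A -> rc_borel B -> B `<=` A ->
  mu A = mu B + mu (A `\` B).
Proof.
move=> rA rB BA; rewrite -radonU; first by rewrite setDUK.
- exact: rB.
- by apply: rc_borelD => //; case: rB.
- by rewrite -subset0 => x [Bx [_]]; apply.
Qed.

Lemma normc_le_variation A B : rc_borel B -> B `<=` A ->
  ((normc (mu B))%:E <= radon_variation mu A)%E.
Proof.
move=> rB BA; apply: ereal_sup_ubound; exists 1%N, (fun=> B); split=> //.
- by move=> i j /= /[!ltnS] /[!leqn0] /eqP -> /eqP ->.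
- by move=> x [i _ /BA].
- by rewrite big_ord_recl big_ord0 addr0.
Qed.

Lemma sum_atoms_le_variation A (s : seq G) : uniq s -> [set` s] `<=` A ->
  ((\sum_(x <- s) normc (mu [set x]))%:E <= radon_variation mu A)%E.
Proof.
move=> us sA; apply: ereal_sup_ubound.
exists (size s), (fun i => [set nth 0 s i]); split.
- by move=> i _; exact: rc_borel1.
- by move=> i j /= si sj [x [/= -> /eqP]]; rewrite nth_uniq// => /eqP.
- by move=> x [i /= si ->]; apply: sA; exact: mem_nth.
- by rewrite (big_nth 0) big_mkord.
Qed.

Lemma notin_msupport x : ~ msupport mu x ->
  exists2 U, open_nbhs x U & forall B, rc_borel B -> B `<=` U -> mu B = 0.
Proof.
move=> /existsNP[U /not_implyP[Ux /negP]]; rewrite -leNgt => U0.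
exists U => // B rB BU; apply: eq0_normc; apply/eqP; rewrite eq_le normc_ge0.
by rewrite andbT -lee_fin (le_trans _ U0)// normc_le_variation.
Qed.

Lemma open_null_disjoint_msupport x U : open_nbhs x U -> 
  (forall B, rc_borel B -> B `<=` U -> mu B = 0) -> U `&` msupport mu = set0.
Proof.
move=> [oU Ux] U0; rewrite -subset0 => y [Uy /(_ _ (conj oU Uy))].
rewrite ltNge => /negP; apply; apply: ge_ereal_sup => _ [n [F [rF tF FU ->]]].
rewrite big1// => i _; rewrite U0 ?normc0//; first exact: rF.
by move=> z Fz; apply: FU; exists i => /=.
Qed.

(** Compact sets off the support are covered by finitely many open sets of
    variation zero; inner regularity passes from compact to Borel sets. *)
Lemma radon_null B : rc_borel B -> B `&` msupport mu = set0 -> mu B = 0.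
Proof.
move=> rB B0.
have Kn K : compact K -> K `<=` B -> mu K = 0.
  move=> cK KB.
  (* Being null is not inherited by unions of arbitrary sets, as the pieces of a
     Borel set need not be Borel: an open null superset is required. *)
  pose P := fun A => exists W, [/\ open W, A `<=` W &
     forall C, rc_borel C -> C `<=` W -> mu C = 0].
  suff: P K by move=> [W [_ KW W0]]; apply: W0 => //; exact: rc_borel_compact.
  apply: (compact_induction (P := P)) cK => //.
  - exists set0; split => //; first exact: open0.
    by move=> C _; rewrite subset0 => ->; exact: radon0.
  - by move=> A A' A'A [W [oW AW W0]]; exists W; split=> //; exact: subset_trans AW.
  - move=> A A' [W [oW AW W0]] [W' [oW' AW' W'0]].
    exists (W `|` W'); split; [exact: openU|exact: setUSS|].
    move=> C rC CW.
    rewrite (radonD rC (rc_borelI rC (borel_open oW))); last by move=> x [].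
    rewrite W0 ?add0r; last by move=> x [].
      rewrite W'0// ?setDIr ?setDv ?set0U.
        by apply: rc_borelD => //; exact: borel_open.
      by move=> x [/CW[]].
    exact: rc_borelI (borel_open oW).
  - move=> x Kx.
    have [|U [oU Ux] U0] := @notin_msupport x.
      by move=> sx; rewrite -[False]/(set0 x) -B0; split=> //; exact: KB.
    by exists U; [exact: open_nbhs_nbhs|exists U; split].
apply: eq0_normc; apply/eqP; rewrite eq_le normc_ge0 andbT.
apply/ler_addgt0Pl => e e0; rewrite addr0.
have [K [cK KB Ke]] := @radon_inner_regular _ _ mu e B e0 rB.
rewrite (radonD rB (rc_borel_compact G_hausdorff cK) KB) (Kn _ cK KB) add0r.
rewrite -lee_fin; apply: le_trans (ltW Ke); apply: normc_le_variation => //.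
by apply: rc_borelD => //; case: (rc_borel_compact G_hausdorff cK).
Qed.

End RadonSupport.

Section DiscreteRadon.
Context {R : realType} {G : topologicalZmodType}.
Hypothesis G_hausdorff : hausdorff_space G.
Variable mu : radon_measure R G.
Hypothesis mu_discrete : discrete_measure mu.
Implicit Types A B K : set G.

Lemma msupport_finite K : compact K -> finite_set (K `&` msupport mu).
Proof.
apply: (compact_induction (P := fun A => finite_set (A `&` msupport mu))).
- by rewrite set0I.
- by move=> A B BA; apply: sub_finite_set; exact: setSI.
- by move=> A B fA fB; rewrite setIUl finite_setU.
move=> x _; have [/mu_discrete[U U0 Ux]|nsx] := pselect (msupport mu x).
  exists [set x + u | u in U]; first exact: nbhs_translate.
  by rewrite Ux; exact: finite_set1.
have [U Ux U0] := notin_msupport nsx.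
exists U; first exact: open_nbhs_nbhs.
by rewrite (open_null_disjoint_msupport Ux U0).
Qed.

Lemma precompact_msupport_finite A : precompact A ->
  finite_set (A `&` msupport mu).
Proof.
rewrite precompactE => /msupport_finite; apply: sub_finite_set.
by apply: setSI; exact: subset_closure.
Qed.

Lemma radon_seq (s : seq G) : uniq s ->
  mu [set` s] = \sum_(x <- s) mu [set x].
Proof.
elim: s => [_|x s IH /= /andP[xs us]].
  by rewrite big_nil set_nil; exact: radon0.
rewrite big_cons -IH// (_ : [set` _] = [set x] `|` [set` s]); last first.
  by apply/seteqP; split=> y /=; rewrite inE => /predU1P.
rewrite radonU//.
- exact: rc_borel1.
- exact: rc_borel_finite.
- by rewrite -subset0 => y [/= -> ys]; rewrite ys in xs.
Qed.

Lemma radon_finite A : finite_set A -> mu A = \sum_(x \in A) mu [set x].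
Proof.
move=> fA; rewrite fsbig_finite//= -radon_seq ?finmap.fset_uniq//.
by congr (mu _); rewrite -[LHS](fset_setK fA).
Qed.

Lemma radon_atomic B : rc_borel B ->
  mu B = \sum_(x \in B `&` msupport mu) mu [set x].
Proof.
move=> rB; have fB : finite_set (B `&` msupport mu).
  by apply: precompact_msupport_finite; case: rB.
rewrite (radonD mu rB (rc_borel_finite G_hausdorff fB)); last by move=> x [].
rewrite radon_finite// radon_null ?addr0//.
  by apply: rc_borelD => //; case: (rc_borel_finite G_hausdorff fB).
by rewrite -subset0 => x [[Bx nx] sx]; apply: nx.
Qed.

Lemma radon_atom0 x : ~ msupport mu x -> mu [set x] = 0.
Proof.
move=> nsx; apply: radon_null => //; first exact: rc_borel1.
by rewrite -subset0 => y [/= -> /nsx].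
Qed.

End DiscreteRadon.

(** * The integral against a discrete measure *)

Section AtomicMeasure.
Context {R : realType} {G : topologicalZmodType}.
Variables (L : set G) (c : G -> R).

(** Negative weights are truncated so that this is a measure for every [c]. *)
Definition atomic_measure (A : set (borelType G)) : \bar R :=
  \esum_(y in (A : set G) `&` L) (Num.max (c y) 0)%:E.

Let atomic_measure0 : atomic_measure set0 = 0%E.
Proof. by rewrite /atomic_measure set0I esum_set0. Qed.

Let atomic_measure_ge0 A : (0 <= atomic_measure A)%E.
Proof. by apply: esum_ge0 => y _; rewrite lee_fin le_max lexx orbT. Qed.

Let atomic_measure_sigma_additive : semi_sigma_additive atomic_measure.
Proof.
move=> F mF tF mUF.
rewrite [X in _ --> X](_ : _ = (\sum_(0 <= i <oo) atomic_measure (F i))%E).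
  apply: is_cvg_ereal_nneg_natsum => n _; exact: atomic_measure_ge0.
rewrite /atomic_measure setI_bigcupl nneseries_sum_bigcup//.
  by move=> i j _ _ [x [[Fi _] [Fj _]]]; apply: tF => //; exists x.
by move=> y; rewrite lee_fin le_max lexx orbT.
Qed.

HB.instance Definition _ := isMeasure.Build _ _ _ atomic_measure
  atomic_measure0 atomic_measure_ge0 atomic_measure_sigma_additive.

End AtomicMeasure.

Section UpperVariation.
Context {R : realType} {G : topologicalZmodType}.
Hypothesis G_hausdorff : hausdorff_space G.
Variables (L : set G) (s : set G -> R).
Hypothesis L_finite : forall A, precompact A -> finite_set (A `&` L).
Hypothesis s_atomic :
  forall B, rc_borel B -> s B = \sum_(y \in B `&` L) s [set y].

(** Among the relatively compact Borel subsets of [A], the largest values of [s]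
    are reached by finite sets of positive atoms, whether [A] is Borel or
    not. *)
Lemma upper_variationE :
  upper_variation s = atomic_measure L (fun y => s [set y]).
Proof.
apply/funext => A; apply/eqP; rewrite eq_le; apply/andP; split.
  apply: ge_ereal_sup => _ [B [rB BA] <-].
  have fB : finite_set (B `&` L) by apply: L_finite; case: rB.
  apply: esum_ge; exists (B `&` L); first by split=> // y [/BA].
  rewrite fsumEFin// lee_fin s_atomic// !fsbig_finite//=.
  by apply: ler_sum => y _; rewrite le_max lexx.
apply: ge_ereal_sup => _ [X [fX XA] <-].
apply: ereal_sup_ubound; exists (X `&` [set y | 0 < s [set y]]).
  split; last by move=> y [/XA[]].
  by apply: rc_borel_finite => //; exact: finite_setIl.
rewrite s_atomic; last by apply: rc_borel_finite => //; exact: finite_setIl.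
rewrite fsumEFin//; congr EFin.
rewrite (_ : _ `&` L = X `&` [set y | 0 < s [set y]]); last first.
  by apply/seteqP; split=> y [] // Xy sy; split=> //; case: (XA _ Xy).
rewrite fsbig_mkcondr; apply: eq_fsbigr => y _.
rewrite /patch; have [sy|sy] := ltP 0 (s [set y]).
  by rewrite mem_set//; apply/esym/max_idPl/ltW.
rewrite memNset /= ?ltNge ?sy//; exact/esym/max_idPr.
Qed.

End UpperVariation.

Section AtomicIntegral.
Context {R : realType} {G : topologicalZmodType}.
Hypothesis G_hausdorff : hausdorff_space G.
Local Open Scope ereal_scope.

Lemma continuous_borel_measurable (f : G -> R) : continuous f ->
  measurable_fun [set: borelType G] (f : borelType G -> R).
Proof.
move=> /continuousP cf; apply: (measurability _ (RGenOInfty.measurableE R)).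
move=> _ [_ [a ->] <-]; rewrite setTI; apply: borel_open.
exact/cf/interval_open.
Qed.

(** On the compact set [C] carrying [phi], the measure is a finite sum of Dirac
    measures. *)
Lemma integral_atomic_measure (L C : set G) (c phi : G -> R) :
  compact C -> finite_set (C `&` L) -> continuous phi ->
  (forall y, 0 <= phi y)%R -> (forall y, ~ C y -> phi y = 0)%R ->
  \int[atomic_measure L c]_(y in [set: borelType G]) (phi y)%:E =
  (\sum_(y \in C `&` L) phi y * Num.max (c y) 0)%R%:E.
Proof.
move=> cC fC cphi phi0 phiC.
have mC : measurable (C : set (borelType G)).
  by apply: borel_closed; exact: compact_closed.
pose x0 : G := 0%R.
pose d := finmap.enum_fset (fset_set (C `&` L)).
have ud : uniq d by exact: finmap.fset_uniq.
have memd y : (y \in d) = (y \in C `&` L) by rewrite -in_fset_set.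
have c0 y : (0 <= Num.max (c y) 0)%R by rewrite le_max lexx orbT.
pose m (k : nat) : {measure set (borelType G) -> \bar R} :=
  mscale (NngNum (c0 (nth x0 d k))) (\d_(nth x0 d k : borelType G)).
have mphi D : measurable_fun D (fun y : borelType G => (phi y)%:E).
  apply: measurable_funTS; apply/measurable_EFinP.
  exact: continuous_borel_measurable.
transitivity (\int[atomic_measure L c]_(y in (C : set (borelType G))) (phi y)%:E).
  rewrite [RHS]integral_mkcond; apply: eq_integral => y _; rewrite /patch.
  by case: ifPn => // /negP; rewrite inE => /phiC ->.
rewrite (eq_measure_integral (msum m (size d))); last first.
  move=> B mB BC.
  rewrite -[LHS]/(\esum_(y in (B : set G) `&` L) (Num.max (c y) 0)%:E).
  rewrite -[RHS]/(\sum_(k < size d) (Num.max (c (nth x0 d k)) 0)%:E *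
    \d_(nth x0 d k : borelType G) B).
  have fB : finite_set (B `&` L) by apply: sub_finite_set fC; exact: setSI.
  rewrite esum_fset//; last by move=> y _; rewrite lee_fin.
  rewrite -(big_mkord xpredT (fun k => (Num.max (c (nth x0 d k)) 0)%:E *
    \d_(nth x0 d k : borelType G) B)).
  rewrite -(big_nth x0 xpredT (fun y => (Num.max (c y) 0)%:E *
    \d_(y : borelType G) B)) [RHS]fsbig_seq//.
  rewrite (_ : B `&` L = [set` d] `&` B); last first.
    apply/seteqP; split=> y /=; rewrite memd inE.
      by move=> [By Ly]; split=> //; split=> //; exact: BC.
    by move=> [[_ Ly] By].
  rewrite fsbig_mkcondr; apply: eq_fsbigr => y _.
  by rewrite /patch diracE; case: ifPn; rewrite ?mule1 ?mule0.
rewrite ge0_integral_measure_sum//; last by move=> y _; rewrite lee_fin.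
under eq_bigr => k _.
  rewrite ge0_integral_mscale//; last by move=> y _; rewrite lee_fin.
  rewrite integral_dirac//= diracE mem_set; last first.
    have : nth x0 d k \in d by exact: mem_nth.
    by rewrite memd inE => -[].
  rewrite mul1e -EFinM mulrC.
  over.
rewrite sumEFin fsbig_finite//=; congr EFin.
by rewrite -/d (big_nth x0) big_mkord.
Qed.

End AtomicIntegral.

Lemma max_sub_maxN (R : realDomainType) (x : R) :
  Num.max x 0 - Num.max (- x) 0 = x.
Proof.
have [x0|x0] := leP 0 x.
  by rewrite (max_idPr _) ?subr0// oppr_le0.
by rewrite (max_idPl _) ?opprK ?add0r// oppr_ge0 ltW.
Qed.

Lemma Re_sum (R : realType) (I : Type) (r : seq I) (P : pred I) (F : I -> R[i]) :
  complex.Re (\sum_(i <- r | P i) F i) = \sum_(i <- r | P i) complex.Re (F i).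
Proof. by apply: (big_morph (@complex.Re R)) => // -[a b] [c d]. Qed.

Lemma Im_sum (R : realType) (I : Type) (r : seq I) (P : pred I) (F : I -> R[i]) :
  complex.Im (\sum_(i <- r | P i) F i) = \sum_(i <- r | P i) complex.Im (F i).
Proof. by apply: (big_morph (@complex.Im R)) => // -[a b] [c d]. Qed.

Section SignedIntegral.
Context {R : realType} {G : topologicalZmodType}.
Hypothesis G_hausdorff : hausdorff_space G.
Variables (L : set G) (s : set G -> R).
Hypothesis L_finite : forall A, precompact A -> finite_set (A `&` L).
Hypothesis s_atomic :
  forall B, rc_borel B -> s B = \sum_(y \in B `&` L) s [set y].

Lemma signed_integral_atomic (C : set G) (phi : G -> R) :
  compact C -> continuous phi -> (forall y, 0 <= phi y) ->
  (forall y, ~ C y -> phi y = 0) ->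
  signed_integral s phi = \sum_(y \in C `&` L) phi y * s [set y].
Proof.
move=> cC cphi phi0 phiC.
have fC : finite_set (C `&` L) by apply: L_finite; exact: compact_precompact.
have sN_atomic B : rc_borel B -> - s B = \sum_(y \in B `&` L) - s [set y].
  move=> rB; have fB : finite_set (B `&` L) by apply: L_finite; case: rB.
  by rewrite s_atomic// !fsbig_finite//= sumrN.
rewrite /signed_integral (upper_variationE G_hausdorff L_finite s_atomic).
rewrite (upper_variationE G_hausdorff L_finite sN_atomic).
rewrite !(integral_atomic_measure _ _ cC)//= !fsbig_finite//= -sumrB.
by apply: eq_bigr => y _; rewrite -mulrBr max_sub_maxN.
Qed.

End SignedIntegral.

Section Convolution.
Context {R : realType} {G : topologicalZmodType}.
Hypothesis G_hausdorff : hausdorff_space G.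
Variable mu : radon_measure R G.
Hypothesis mu_discrete : discrete_measure mu.

Lemma complex_integral_atomic (C : set G) (phi : G -> R) :
  compact C -> continuous phi -> (forall y, 0 <= phi y) ->
  (forall y, ~ C y -> phi y = 0) ->
  complex_integral mu (fun y => (phi y)%:C%C) =
  \sum_(y \in C `&` msupport mu) (phi y)%:C%C * mu [set y].
Proof.
move=> cC cphi phi0 phiC.
have Lf A : precompact A -> finite_set (A `&` msupport mu).
  exact: precompact_msupport_finite.
have sRe B : rc_borel B ->
    complex.Re (mu B) = \sum_(y \in B `&` msupport mu) complex.Re (mu [set y]).
  move=> rB; have fB : finite_set (B `&` msupport mu) by apply: Lf; case: rB.
  by rewrite radon_atomic// !fsbig_finite//= Re_sum.
have sIm B : rc_borel B ->
    complex.Im (mu B) = \sum_(y \in B `&` msupport mu) complex.Im (mu [set y]).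
  move=> rB; have fB : finite_set (B `&` msupport mu) by apply: Lf; case: rB.
  by rewrite radon_atomic// !fsbig_finite//= Im_sum.
have fC : finite_set (C `&` msupport mu) by apply: Lf; exact: compact_precompact.
have Re0 : signed_integral (fun A => complex.Re (mu A)) (fun=> 0) = 0.
  rewrite (signed_integral_atomic G_hausdorff Lf sRe cC)//; last exact: cst_continuous.
  by apply: fsbig1 => y _; rewrite mul0r.
have Im0 : signed_integral (fun A => complex.Im (mu A)) (fun=> 0) = 0.
  rewrite (signed_integral_atomic G_hausdorff Lf sIm cC)//; last exact: cst_continuous.
  by apply: fsbig1 => y _; rewrite mul0r.
rewrite /complex_integral /= Re0 Im0 subr0 add0r.
rewrite (signed_integral_atomic G_hausdorff Lf sRe cC)//.
rewrite (signed_integral_atomic G_hausdorff Lf sIm cC)//.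
rewrite !fsbig_finite//=.
apply/eqP; rewrite eq_complex Re_sum Im_sum /=; apply/andP; split; apply/eqP.
  apply: eq_bigr => y _; by case: (mu _) => a b /=; rewrite mul0r subr0.
by apply: eq_bigr => y _; case: (mu _) => a b /=; rewrite mul0r addr0.
Qed.

(** The part of the convolution that is due to the atoms of [mu] in [L]. *)
Definition atom_conv (phi : G -> R) (L : set G) (x : G) : R[i] :=
  \sum_(y \in L) (phi (x - y))%:C%C * mu [set y].

Lemma convolution_atoms (C : set G) (phi : G -> R) (x : G) :
  compact C -> continuous phi -> (forall y, 0 <= phi y) ->
  (forall y, ~ C y -> phi y = 0) ->
  convolution (fun z => (phi z)%:C%C) mu x = atom_conv phi setT x.
Proof.
move=> cC cphi phi0 phiC; rewrite /convolution.
have xC y : ~ [set x - y | y in C] y -> phi (x - y) = 0.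
  move=> nCy; apply: phiC => Cy; apply: nCy.
  by exists (x - y) => //; rewrite subKr.
have cxC := compact_reflect (x := x) cC.
rewrite (complex_integral_atomic (phi := fun y => phi (x - y)) cxC)//.
  apply: fsbig_widen => // y [_ /not_andP nCm] /=.
  case: nCm => [/xC ->|my]; first by rewrite mul0r.
  by rewrite radon_atom0// mulr0.
move=> y; apply: (@continuous_comp _ _ _ (fun y => x - y) phi).
  exact: continuous_reflect.
exact: cphi.
Qed.

End Convolution.

(** * Almost periodic functions at infinity *)

Section AlmostPeriodic.
Context {R : realType} {G : topologicalZmodType}.
Hypothesis G_not_compact : ~ compact [set: G].
Implicit Types g h : G -> R[i].

Definition at_infinity : set_system G :=
  [set A | exists2 K, compact K & ~` K `<=` A].

Lemma at_infinity_proper : ProperFilter at_infinity.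
Proof.
apply: Build_ProperFilter_ex.
  move=> A [K cK KA]; apply: contrapT => A0; apply: G_not_compact.
  rewrite (_ : [set: G] = K)//; apply/seteqP; split=> // x _.
  by apply: contrapT => /KA Ax; apply: A0; exists x.
split.
- by exists set0; [exact: compact0|].
- move=> A B [K cK KA] [K' cK' KB]; exists (K `|` K'); first exact: compactU.
  by rewrite setCU => x [/KA Ax /KB Bx].
- by move=> A B AB [K cK KA]; exists K => //; exact: subset_trans AB.
Qed.

Lemma translate_Cu g (t : G) : Cu g -> Cu (fun x => g (x - t)).
Proof.
move=> [[M gM] gu]; split; first by exists M => x; exact: gM.
move=> e /gu; apply: filterS => u hu x.
by rewrite -addrAC; exact: hu.
Qed.

(** For an ultrafilter, clustering to [h] means converging to [h]. *)
Lemma almost_periodic_cluster g (U : set_system G) : UltraFilter U ->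
  almost_periodic_fun g ->
  exists h, forall e : R, 0 < e ->
    U [set t | forall y, normc (h y - g (y - t)) < e].
Proof.
move=> UU [Cg cg].
pose tau (t : G) : {uniform G -> R[i]} := fun x => g (x - t).
have [|h [_ hU]] := cg (tau @ U) _.
  suff: U setT; last exact: filterT.
  apply: (@filterS _ U) => t _; split; last exact: (translate_Cu t Cg).
  by move=> N Nt; exists (tau t); split; [exists t|exact: nbhs_singleton].
exists h => e e0.
have hN : nbhs (h : {uniform G -> R[i]}) [set k | forall y, normc (h y - k y) < e].
  apply/uniform_nbhs; eexists; split; first exact: (entourage_normc e0).
  by move=> k /= hk y; exact: hk.
have [//|nU] := in_ultra_setVsetC [set t | forall y, normc (h y - g (y - t)) < e] UU.
have [k [nk hk]] := hU (~` [set k | forall y, normc (h y - k y) < e]) _ nU hN.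
by case: (nk hk).
Qed.

(** Along an ultrafilter finer than the filter at infinity, the translates of
    both functions converge uniformly.  Two parameters [t] and [t'] of this
    ultrafilter thus give uniformly close translates of [g1] and of [g2]; with
    [t] far enough from [t'], the value of [g1 - g2] at [x0] is compared with
    one outside of [K].  The same ultrafilter serves [g1] and [g2], which avoids
    going through the almost periodicity of [g1 - g2]. *)
Lemma almost_periodic_eq g1 g2 :
  almost_periodic_fun g1 -> almost_periodic_fun g2 ->
  (forall e : R, 0 < e -> exists2 K, compact K &
     forall x, ~ K x -> normc (g1 x - g2 x) < e) ->
  g1 = g2.
Proof.
move=> ap1 ap2 g12; apply/funext => x0; apply/eqP; rewrite -subr_eq0.
apply/negPn/negP => gx0.
pose eta := normc (g1 x0 - g2 x0).
have eta0 : 0 < eta.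
  rewrite lt_neqAle normc_ge0 andbT eq_sym; apply: contra gx0 => /eqP h.
  by apply/eqP; exact: eq0_normc.
have [U [UU atU]] := ultraFilterLemma at_infinity_proper.
(* Each [g i] moves by less than [2 * eta / 8], which leaves [eta / 2] for the
   value outside of [K]. *)
have e8 : 0 < eta / 8 by rewrite divr_gt0.
have [h1 /(_ _ e8) U1] := almost_periodic_cluster UU ap1.
have [h2 /(_ _ e8) U2] := almost_periodic_cluster UU ap2.
have e2 : 0 < eta / 2 by rewrite divr_gt0.
have [K cK Ksmall] := g12 _ e2.
have [t' [t'1 t'2]] := filter_ex (filterI U1 U2).
have UK : U (~` [set x0 + t' - k | k in K]).
  apply: atU; exists [set x0 + t' - k | k in K] => //.
  exact: compact_reflect.
have [t [[t1 t2] nKt]] := filter_ex (filterI (filterI U1 U2) UK).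
have near (g h : G -> R[i]) : (forall y, normc (h y - g (y - t)) < eta / 8) ->
    (forall y, normc (h y - g (y - t')) < eta / 8) ->
    normc (g x0 - g (x0 + t' - t)) < eta / 4.
  move=> ht ht'; have a := ht (x0 + t'); have := ht' (x0 + t'); rewrite addrK => b.
  have := normcD (g x0 - h (x0 + t')) (h (x0 + t') - g (x0 + t' - t)).
  rewrite addrA subrK normcB => c; apply: le_lt_trans c _.
  rewrite (_ : eta / 4 = eta / 8 + eta / 8) ?ltrD//.
  by lra.
have n1 := near _ _ t1 t'1; have n2 := near _ _ t2 t'2.
have n3 : normc (g1 (x0 + t' - t) - g2 (x0 + t' - t)) < eta / 2.
  apply: Ksmall => Kt; apply: nKt; exists (x0 + t' - t) => //.
  by rewrite subKr.
have : eta <= normc (g1 x0 - g1 (x0 + t' - t)) +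
    normc (g1 (x0 + t' - t) - g2 (x0 + t' - t)) +
    normc (g2 x0 - g2 (x0 + t' - t)).
  rewrite [X in _ + X]normcB.
  rewrite /eta (_ : g1 x0 - g2 x0 = g1 x0 - g1 (x0 + t' - t) +
    (g1 (x0 + t' - t) - g2 (x0 + t' - t)) + (g2 (x0 + t' - t) - g2 x0)).
    by apply: le_trans (normcD _ _) _; rewrite lerD2r normcD.
  by rewrite subrKA subrKA.
by move: n1 n2 n3; lra.
Qed.

End AlmostPeriodic.

(** * Bump functions *)

Section Bump.
Context {R : realType} {G : topologicalZmodType}.
Hypothesis G_hausdorff : hausdorff_space G.
Hypothesis G_locally_compact : locally_compact [set: G].

Lemma compact_nbhs (x : G) : exists2 C : set G, nbhs x C & compact C.
Proof.
have [N] := G_locally_compact (I : [set: G] x); rewrite withinET.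
by move=> Nx [cN _]; exists N.
Qed.

(** Complete regularity, applied inside a compact neighborhood of [0]. *)
Lemma bump (W : set G) : nbhs 0 W ->
  exists phi : G -> R, exists C : set G,
  [/\ continuous phi, compact C, (forall y, 0 <= phi y <= 1), phi 0 = 1 &
    forall y, phi y != 0 -> C y /\ W y].
Proof.
move=> W0; have [C C0 cC] := compact_nbhs 0.
have : nbhs 0 (C `&` W) by exact: filterI.
rewrite nbhsE => -[V [oV V0] VCW].
have /uniform_separatorP : uniform_separator [set 0] (~` V).
  by apply: (@locally_compact_completely_regular G R) => //; exact: open_closedC.
move=> /(_ R)[f [cf f01 f0 f1]].
exists (fun y => 1 - f y), C; split=> //.
- by move=> y; apply: cvgB; [exact: cvg_cst|exact: cf].
- move=> y; have /= : `[0, 1]%classic (f y) by apply: f01; exists y.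
  by rewrite in_itv /= => /andP[h0 h1]; rewrite subr_ge0 h1 /= gerBl.
- by rewrite (_ : f 0 = 0) ?subr0//; apply: f0; exists 0.
- move=> y; rewrite subr_eq0 => fy; apply: VCW; apply: contrapT => nVy.
  by move/eqP: fy; apply; apply/esym/f1; exists y.
Qed.

Lemma bump_Cc (phi : G -> R) (C : set G) : continuous phi -> compact C ->
  (forall y, phi y != 0 -> C y) -> Cc (fun y => (phi y)%:C%C).
Proof.
move=> cphi cC phiC; split.
  move=> y A /nbhs_normcP[e e0 eA].
  have h : nbhs y [set z | ball (phi y) e (phi z)].
    exact: (cphi y _ (nbhsx_ballx (phi y) e e0)).
  suff : nbhs y ((fun y => (phi y)%:C%C) @^-1` A) by [].
  by apply: filterS h => z yz; apply: eA; rewrite -rmorphB normc_real.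
rewrite -precompactE; apply: precompact_subset (compact_precompact G_hausdorff cC).
move=> y /= py; apply: phiC; apply: contra py => /eqP ->; exact/eqP.
Qed.

(** Uniform continuity near the points of the compact set [C] suffices: when
    [z + v] is in [C] but [z] is not, start from [z + v] and move by [- v]. *)
Lemma bump_unif_continuous (phi : G -> R) (C : set G) (e : R) :
  continuous phi -> compact C -> (forall y, phi y != 0 -> C y) -> 0 < e ->
  exists2 V : set G, nbhs 0 V & forall v z, V v -> `|phi (z + v) - phi z| < e.
Proof.
move=> cphi cC phiC e0.
have nearC : \forall v \near (0 : G), C `<=` [set z | `|phi (z + v) - phi z| < e].
  apply: (compact_near_coveringP C).1 => // z Cz.
  have cg : {for (z, 0 : G), continuous (fun p : G * G => phi (p.1 + p.2) - phi p.1)}.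
    apply: cvgB; apply: continuous_comp => //; try exact: cphi.
      exact: add_continuous.
    exact: cvg_fst.
  have h : nbhs (z, 0 : G) [set p | ball (phi (z + 0) - phi z) e
      (phi (p.1 + p.2) - phi p.1)].
    exact: (cg _ (nbhsx_ballx _ e e0)).
  by apply: filterS h => p; rewrite addr0 subrr /ball /= sub0r normrN.
have nearN := nbhs_opp0 nearC.
exists [set v | C `<=` [set z | `|phi (z + v) - phi z| < e] /\
                C `<=` [set z | `|phi (z - v) - phi z| < e]].
  exact: (filterI nearC nearN).
move=> v z [h hN].
have [Cz|nCz] := pselect (C z); first exact: h.
have [Czv|nCzv] := pselect (C (z + v)).
  by have := hN _ Czv; rewrite /= addrK distrC.
have -> : phi z = 0 by apply/eqP/negP => /negP/phiC.
have -> : phi (z + v) = 0 by apply/eqP/negP => /negP/phiC.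
by rewrite subrr normr0.
Qed.

End Bump.

(** * Sums over blocks of atoms *)

Lemma sum_partition (V : nmodType) (I J : eqType) (D : seq I) (T : seq J)
    (P : J -> pred I) (F : I -> V) : uniq T ->
  (forall y, y \in D -> F y != 0 -> exists2 j, j \in T & P j y) ->
  (forall y i j, P i y -> P j y -> i = j) ->
  \sum_(y <- D) F y = \sum_(j <- T) \sum_(y <- D | P j y) F y.
Proof.
move=> uT cov disj; rewrite (exchange_big_dep xpredT)//=.
rewrite big_seq [RHS]big_seq; apply: eq_bigr => y yD.
have [->|Fy] := eqVneq (F y) 0; first by rewrite big1.
have [j jT Pjy] := cov y yD Fy.
rewrite big_mkcond (bigD1_seq j)//= Pjy big1 ?addr0// => i ij.
by case: ifPn => // Piy; rewrite (disj _ _ _ Piy Pjy) eqxx in ij.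
Qed.

Section Mass.
Context {R : realType} {G : topologicalZmodType}.
Variable mu : set G -> R[i].

Lemma mass_finite (L : set G) : finite_set L ->
  mass mu L = \sum_(y \in L) mu [set y].
Proof.
move=> fL; rewrite /mass /sum.
pose f x := if x \in L then mu [set x] else 0.
suff h : \forall X \near totally, partial_sum f X = \sum_(y \in L) mu [set y].
  have tF : ProperFilter (@totally G) by exact: totally_filter.
  apply: cvg_lim; first exact: norm_hausdorff.
  move=> N Nc; have {}h : totally [set X | N (partial_sum f X)]; last exact: h.
  by apply: filterS h => X /= ->; exact: nbhs_singleton Nc.
exists (fset_set L) => // X /= LX.
rewrite /partial_sum -(finmap.big_seq_fsetE _ X xpredT f) /=.
transitivity (\sum_(y \in L) f y).
  apply/esym/fsbig_fwiden => [y Ly||y [_ nLy]] /=.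
  - by apply: (finmap.fsubsetP LX); rewrite in_fset_set// mem_set.
  - exact: finmap.fset_uniq.
  - by rewrite /f memNset.
by apply: eq_fsbigr => y yL; rewrite /f yL.
Qed.

(** Finite families of atoms outside of [X] are small, as [X] exhausts the sum
    of all of them up to [e]. *)
Lemma abs_summable_tail (L : set G) (e : R) : 0 < e -> abs_summable mu L ->
  exists2 X : set G, finite_set X & forall s : seq G, uniq s ->
    (forall y, y \in s -> L y /\ ~ X y) -> \sum_(y <- s) normc (mu [set y]) < e.
Proof.
move=> e0 sL.
have L0 : (0 <= \esum_(x in L) (normc (mu [set x]))%:E)%E.
  by apply: esum_ge0 => y _; rewrite lee_fin normc_ge0.
have fL : (\esum_(x in L) (normc (mu [set x]))%:E)%E \is a fin_num.
  by rewrite ge0_fin_numE.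
have [_ [X [fX XL] <-]] := ub_ereal_sup_adherent e0 fL.
rewrite -[ereal_sup _]/(\esum_(x in L) (normc (mu [set x]))%:E)%E => Xe.
exists X => // s us sLX.
have : (\sum_(y \in X `|` [set` s]) (normc (mu [set y]))%:E <=
  \esum_(x in L) (normc (mu [set x]))%:E)%E.
  apply: ereal_sup_ubound; exists (X `|` [set` s]) => //; split.
    by rewrite finite_setU; split=> //; exact: finite_seq.
  by move=> y [/XL//|/= /sLX[]].
rewrite fsbigU0//; first last.
- by move=> y [Xy /= /sLX[]].
- exact: finite_seq.
have -> : (\sum_(y \in [set` s]) (normc (mu [set y]))%:E)%E =
    (\sum_(y <- s) normc (mu [set y]))%:E by rewrite -fsbig_seq// sumEFin.
move: Xe; rewrite fsumEFin// -(fineK fL) -EFinB /=.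
rewrite lte_fin => Xe h.
have : \sum_(y \in X) normc (mu [set y]) + \sum_(y <- s) normc (mu [set y]) <=
    fine (\esum_(x in L) (normc (mu [set x]))%:E).
  by rewrite -lee_fin; exact: h.
by move: Xe; lra.
Qed.

End Mass.

Section AtomConv.
Context {R : realType} {G : topologicalZmodType}.
Hypothesis G_hausdorff : hausdorff_space G.
Variables (phi : G -> R) (C : set G).
Hypothesis C_compact : compact C.
Hypothesis phi01 : forall y, 0 <= phi y <= 1.
Hypothesis phiC : forall y, phi y != 0 -> C y.
Variable mu : radon_measure R G.
Hypothesis mu_discrete : discrete_measure mu.

Lemma bump_support_finite x :
  finite_set [set y | phi (x - y) != 0 /\ msupport mu y].
Proof.
have cxC := compact_reflect (x := x) C_compact.
apply: sub_finite_set (msupport_finite mu_discrete cxC) => y [/phiC Cy my].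
by split=> //; exists (x - y) => //; rewrite subKr.
Qed.

Lemma atom_conv_seq (L : set G) (x : G) (D : seq G) : uniq D ->
  (forall y, L y -> msupport mu y -> phi (x - y) != 0 -> y \in D) ->
  atom_conv mu phi L x =
  \sum_(y <- D | y \in L) (phi (x - y))%:C%C * mu [set y].
Proof.
move=> uD LD; rewrite /atom_conv (fsbigE [seq y <- D | y \in L]).
- by rewrite big_filter_cond; apply: eq_bigl => y; rewrite andbb.
- exact: filter_uniq.
- by move=> y /=; rewrite mem_filter => /andP[/set_mem].
- move=> y Ly; rewrite mem_filter mem_set//= => nyD.
  have [->|p0] := eqVneq (phi (x - y)) 0; first by rewrite mul0r.
  by rewrite radon_atom0 ?mulr0// => my; rewrite LD in nyD.
Qed.

(** Far away, [phi (x - _)] only sees atoms outside of the finite set that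
    carries almost all of the mass of [L]. *)
Lemma atom_conv_at_infinity (L : set G) (e : R) : abs_summable mu L -> 0 < e ->
  at_infinity [set x | normc (atom_conv mu phi L x) < e].
Proof.
move=> sL e0; have [X fX Xe] := abs_summable_tail e0 sL.
exists [set p.1 + p.2 | p in X `*` C].
  apply: continuous_compact.
    by apply: continuous_subspaceT; exact: add_continuous.
  by apply: compact_setX => //; exact: finite_compact.
move=> x xXC /=.
have fD : finite_set (L `&` [set y | phi (x - y) != 0 /\ msupport mu y]).
  exact/finite_setIr/bump_support_finite.
pose D := finmap.enum_fset (fset_set
  (L `&` [set y | phi (x - y) != 0 /\ msupport mu y])).
have DP y : y \in D -> L y /\ (phi (x - y) != 0 /\ msupport mu y).
  by rewrite in_fset_set// => /set_mem.
rewrite (@atom_conv_seq _ _ D); [|exact: finmap.fset_uniq|]; last first.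
  by move=> y Ly my p0; rewrite in_fset_set// mem_set.
apply: le_lt_trans (normc_sum _ _ _) _.
apply: le_lt_trans (Xe D _ _); last first.
- move=> y /DP[Ly [p0 _]]; split=> // Xy; apply: xXC; exists (y, x - y) => /=.
    by split=> //=; exact: phiC.
  by rewrite addrC subrK.
- exact: finmap.fset_uniq.
rewrite big_mkcond; apply: ler_sum => y _; case: ifP => _; last exact: normc_ge0.
rewrite normcM normc_real ger0_norm; last by case/andP: (phi01 (x - y)).
by rewrite ler_piMl ?normc_ge0//; case/andP: (phi01 (x - y)).
Qed.

Lemma translation_bounded_atoms (K : set G) : translation_bounded mu ->
  compact K -> exists2 M : R, 0 <= M & forall (t : G) (L : set G),
    finite_set L -> L `<=` [set k + t | k in K] ->
    \sum_(y \in L) normc (mu [set y]) <= M.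
Proof.
move=> tb cK; have := tb _ cK; set v := ereal_sup _ => voo.
have le_v t : (radon_variation mu [set (k + t)%R | k in K] <= v)%E.
  by apply: ereal_sup_ubound; exists t.
have v0 : (0 <= v)%E.
  apply: le_trans (le_v 0); rewrite -[leLHS]/((0:R)%:E) -(normc0 R) -(radon0 mu).
  by apply: normc_le_variation => //; exact: rc_borel0.
have vfin : v \is a fin_num by rewrite ge0_fin_numE.
exists (fine v); first exact: fine_ge0.
move=> t L fL LK; rewrite -lee_fin fineK// fsbig_finite//=.
apply: le_trans (le_v t).
apply: sum_atoms_le_variation => //; first exact: finmap.fset_uniq.
by move=> y /=; rewrite in_fset_set// => /set_mem/LK.
Qed.

End AtomConv.

Section FarBlock.
Context {R : realType} {G : choiceType}.

(** Replacing [w] by its value at [y0] costs at most [d] per unit of mass; what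
    remains is [w y0] times the difference of the total masses. *)
Lemma far_block (a b : G -> R[i]) (w : G -> R) (L L' : set G) (y0 : G)
    (d e M M' : R) : finite_set L -> finite_set L' -> 0 <= d ->
  (forall y, (L `|` L') y -> `|w y - w y0| <= d) -> 0 <= w y0 <= 1 ->
  \sum_(y \in L) normc (a y) <= M -> \sum_(y \in L') normc (b y) <= M' ->
  normc (\sum_(y \in L) a y - \sum_(y \in L') b y) <= e ->
  normc (\sum_(y \in L) (w y)%:C%C * a y - \sum_(y \in L') (w y)%:C%C * b y)
    <= e + d * (M + M').
Proof.
move=> fL fL' d0 wd /andP[w0 w1] aM bM abe.
have osc (c : G -> R[i]) (S : set G) (m : R) : finite_set S ->
    (forall y, S y -> `|w y - w y0| <= d) -> \sum_(y \in S) normc (c y) <= m ->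
    normc (\sum_(y \in S) (w y)%:C%C * c y - (w y0)%:C%C * \sum_(y \in S) c y)
      <= d * m.
  move=> fS Sd cm; rewrite !fsbig_finite//= in cm *.
  rewrite mulr_sumr -sumrB; apply: le_trans (normc_sum _ _ _) _.
  apply: le_trans (ler_wpM2l d0 cm); rewrite mulr_sumr big_seq [leRHS]big_seq.
  apply: ler_sum => y; rewrite in_fset_set// => /set_mem Sy.
  rewrite -mulrBl normcM -rmorphB normc_real.
  by apply: ler_wpM2r; [exact: normc_ge0|exact: Sd].
have oa := osc a L M fL (fun y Ly => wd y (or_introl Ly)) aM.
have ob := osc b L' M' fL' (fun y Ly => wd y (or_intror Ly)) bM.
set sa := \sum_(y \in L) (w y)%:C%C * a y in oa *.
set sb := \sum_(y \in L') (w y)%:C%C * b y in ob *.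
set ma := \sum_(y \in L) a y in oa abe.
set mb := \sum_(y \in L') b y in ob abe.
have -> : sa - sb = (sa - (w y0)%:C%C * ma) - (sb - (w y0)%:C%C * mb) +
   (w y0)%:C%C * (ma - mb) by ring.
have h1 : normc ((w y0)%:C%C * (ma - mb)) <= e.
  rewrite normcM normc_real ger0_norm//; apply: le_trans abe.
  by rewrite ler_piMl// normc_ge0.
apply: le_trans (normcD _ _) _; rewrite addrC; apply: lerD h1 _.
apply: le_trans (normcD _ _) _; rewrite normcN mulrDr; exact: lerD oa ob.
Qed.

End FarBlock.

(** * The two measures coincide *)

Section Comparison.
Context {R : realType} {G : topologicalZmodType}.
Hypothesis G_hausdorff : hausdorff_space G.
Hypothesis G_locally_compact : locally_compact [set: G].
Hypothesis G_not_compact : ~ compact [set: G].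
Variables mu nu : radon_measure R G.
Hypothesis mu_discrete : discrete_measure mu.
Hypothesis nu_discrete : discrete_measure nu.
Hypothesis mu_translation_bounded : translation_bounded mu.
Hypothesis nu_translation_bounded : translation_bounded nu.
Variables (A : choiceType) (Lambda Gamma : A -> set G).
Hypothesis Lambda_cover : msupport mu = \bigcup_a Lambda a.
Hypothesis Gamma_cover : msupport nu = \bigcup_a Gamma a.
Hypothesis Lambda_disjoint : forall a b, a <> b -> Lambda a `&` Lambda b = set0.
Hypothesis Gamma_disjoint : forall a b, a <> b -> Gamma a `&` Gamma b = set0.
Hypothesis Lambda_summable : forall a, abs_summable mu (Lambda a).
Hypothesis Gamma_summable : forall a, abs_summable nu (Gamma a).

Let meets (K : set G) : set A := [set a | (K `&` (Lambda a `|` Gamma a)) !=set0].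

Variables (U : set G) (N : nat).
Hypothesis U0 : nbhs (0 : G) U.
Hypothesis U_meets : forall x, (meets [set x + u | u in U] #<= `I_N)%card.
Hypothesis close_blocks : forall (V : set G) (e : R), nbhs (0 : G) V -> 0 < e ->
  exists2 K : set G, compact K &
    forall a, (Lambda a `|` Gamma a) `&` K = set0 ->
      (forall x, (Lambda a `|` Gamma a) x ->
         Lambda a `|` Gamma a `<=` [set x + v | v in V]) /\
      normc (mass mu (Lambda a) - mass nu (Gamma a)) < e.

Lemma finite_meets K : compact K -> finite_set (meets K).
Proof.
apply: (compact_induction (P := fun K => finite_set (meets K))).
- rewrite (_ : meets set0 = set0)//.
  by apply/seteqP; split=> a // [y []].
- move=> K1 K2 K21; apply: sub_finite_set => a [y [Ky ay]].
  by exists y; split=> //; exact: K21.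
- move=> K1 K2 f1 f2; apply: (@sub_finite_set _ _ (meets K1 `|` meets K2)).
    by move=> a [y [[Ky|Ky] ay]]; [left|right]; exists y.
  by rewrite finite_setU.
- move=> x _; exists [set x + u | u in U]; first exact: nbhs_translate.
  by apply/finite_set_leP; exists N.
Qed.

Variables (phi : G -> R) (C : set G).
Hypothesis phi_continuous : continuous phi.
Hypothesis C_compact : compact C.
Hypothesis phi01 : forall y, 0 <= phi y <= 1.
Hypothesis phiC : forall y, phi y != 0 -> C y /\ U (- y).

Let phi_C y : phi y != 0 -> C y. Proof. by case/phiC. Qed.

Let block a x := atom_conv mu phi (Lambda a) x - atom_conv nu phi (Gamma a) x.

(** Blocks that meet the compact set [K] are finitely many and are small one by
    one; the others are small by [far_block], uniformly. *)
Lemma blocks_at_infinity (e : R) : 0 < e ->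
  at_infinity [set x | forall a, normc (block a x) < e].
Proof.
move=> e0; have [C0 C00 cC0] := compact_nbhs G_locally_compact 0.
have [M M0 muM] := translation_bounded_atoms G_hausdorff mu_translation_bounded cC0.
have [M' M'0 nuM'] := translation_bounded_atoms G_hausdorff nu_translation_bounded cC0.
(* The [+ 1] keeps the denominator positive. *)
pose d := e / 4 / (M + M' + 1).
have MM : 0 < M + M' + 1 by lra.
have d0 : 0 < d by rewrite !divr_gt0.
have [V V0 Vd] := bump_unif_continuous phi_continuous C_compact phi_C d0.
(* [phi (x - y)] is compared with [phi (x - y0)] for [y = y0 + v], hence the
   sign; [C0] makes the far blocks finite with a common bound on their mass. *)
pose V' := [set v | V (- v)] `&` C0.
have V'0 : nbhs 0 V' by apply: filterI => //; exact: nbhs_opp0.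
have e2 : 0 < e / 2 by lra.
have [K cK far] := close_blocks V'0 e2.
have FF : Filter (@at_infinity G).
  exact: (@filter_filter _ _ (at_infinity_proper G_not_compact)).
have near a : at_infinity [set x |
    normc (atom_conv mu phi (Lambda a) x) < e / 2 /\
    normc (atom_conv nu phi (Gamma a) x) < e / 2].
  by apply: filterI; apply: (atom_conv_at_infinity G_hausdorff C_compact).
have [T TK] := finite_fsetP.1 (finite_meets cK).
have := @filter_bigI _ _ T _ _ FF (fun a _ => near a).
rewrite -TK; apply: filterS => x near_small a /=.
have [/near_small [/= n1 n2]|nKa] := pselect (meets K a).
  by apply: le_lt_trans (normcD _ _) _; rewrite normcN; lra.
have Ka : (Lambda a `|` Gamma a) `&` K = set0.
  by rewrite -subset0 => y [ay Ky]; apply: nKa; exists y.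
have [small mass_close] := far a Ka.
have [[y0 ay0]|a0] := pselect ((Lambda a `|` Gamma a) !=set0); last first.
  have L0 : Lambda a = set0.
    by rewrite -subset0 => y ay; apply: a0; exists y; left.
  have G0 : Gamma a = set0.
    by rewrite -subset0 => y ay; apply: a0; exists y; right.
  by rewrite /block /atom_conv L0 G0 !fsbig_set0 subr0 normc0.
have aC0 : Lambda a `|` Gamma a `<=` [set k + y0 | k in C0].
  by move=> y /(small y0 ay0)[v [_ Cv] <-]; exists v => //; rewrite addrC.
have cC0y := compact_translate (x := y0) cC0.
have fL : finite_set (Lambda a).
  apply: sub_finite_set (msupport_finite mu_discrete cC0y) => y ay.
  by split; [apply: aC0; left|rewrite Lambda_cover; exists a].
have fG : finite_set (Gamma a).
  apply: sub_finite_set (msupport_finite nu_discrete cC0y) => y ay.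
  by split; [apply: aC0; right|rewrite Gamma_cover; exists a].
apply: (@le_lt_trans _ _ (e / 2 + d * (M + M'))).
  apply: (@far_block _ _ _ _ (fun y => phi (x - y)) _ _ y0) => //.
  - exact: ltW.
  - move=> y /(small y0 ay0)[v [Vv _] <-].
    by rewrite opprD addrA; apply/ltW/Vd.
  - by apply: muM => // y ay; apply: aC0; left.
  - by apply: nuM' => // y ay; apply: aC0; right.
  - by rewrite -!mass_finite//; exact: ltW.
have : d * (M + M') <= e / 4.
  rewrite /d mulrAC ler_pdivrMr// ler_wpM2l//; lra.
lra.
Qed.

(** Since [phi] is supported in [- U], only the at most [N] blocks that meet
    [x + U] contribute at [x]. *)
Lemma convolution_difference_at_infinity (e : R) : 0 < e ->
  at_infinity [set x | normc (convolution (fun z => (phi z)%:C%C) mu x -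
                              convolution (fun z => (phi z)%:C%C) nu x) < e].
Proof.
move=> e0.
have N0 : 0 < N.+1%:R :> R by rewrite ltr0n.
have eN : 0 < e / N.+1%:R by rewrite divr_gt0.
have FF : Filter (@at_infinity G).
  exact: (@filter_filter _ _ (at_infinity_proper G_not_compact)).
apply: filterS (blocks_at_infinity eN) => x block_small; rewrite /mkset.
pose D1 := [set y | phi (x - y) != 0 /\ msupport mu y].
pose D2 := [set y | phi (x - y) != 0 /\ msupport nu y].
have f1 : finite_set D1 by exact: (bump_support_finite C_compact phi_C).
have f2 : finite_set D2 by exact: (bump_support_finite C_compact phi_C).
pose D := finmap.enum_fset (fset_set (D1 `|` D2)).
have fD : finite_set (D1 `|` D2) by rewrite finite_setU.
have uD : uniq D by exact: finmap.fset_uniq.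
have DP y : (y \in D) = (y \in D1 `|` D2) by rewrite in_fset_set.
pose T := finmap.enum_fset (fset_set (meets [set x + u | u in U])).
have fT : finite_set (meets [set x + u | u in U]).
  by apply/finite_set_leP; exists N.
have uT : uniq T by exact: finmap.fset_uniq.
have sT : (size T <= N)%N by exact: geq_card_fset_set.
have TP a y : (Lambda a `|` Gamma a) y -> phi (x - y) != 0 -> a \in T.
  move=> ay /phiC[_ Uy]; rewrite in_fset_set// mem_set//; exists y; split=> //.
  by exists (- (x - y)) => //; rewrite opprB addrC subrK.
have phi_ge0 y : 0 <= phi y by case/andP: (phi01 y).
have phi_out y : ~ C y -> phi y = 0.
  by move=> nCy; apply/eqP/negP => /negP/phi_C.
have sum_blocks (m : radon_measure R G) (S : A -> set G) :
    discrete_measure m ->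
    msupport m = \bigcup_a S a -> (forall a, S a `<=` Lambda a `|` Gamma a) ->
    (forall a b, a <> b -> S a `&` S b = set0) ->
    (forall y, msupport m y -> phi (x - y) != 0 -> y \in D) ->
    convolution (fun z => (phi z)%:C%C) m x = \sum_(a <- T) atom_conv m phi (S a) x.
  move=> md mS SLG Sdisj mD.
  rewrite (convolution_atoms G_hausdorff md x C_compact)//.
  rewrite (atom_conv_seq G_hausdorff uD) => [|y _]; last exact: mD.
  rewrite (eq_bigl xpredT) => [|y]; last exact: in_setT.
  rewrite (@sum_partition _ _ _ _ T (fun a y => y \in S a))//.
  - apply: eq_bigr => a _; apply/esym/atom_conv_seq => //.
    by move=> y _; exact: mD.
  - move=> y yD py0.
    have p0 : phi (x - y) != 0.
      by apply: contra py0 => /eqP ->; rewrite mul0r.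
    have my : msupport m y.
      by apply: contrapT => /radon_atom0 m0; rewrite m0// mulr0 eqxx in py0.
    move: my; rewrite mS => -[a _ Sy]; exists a; last exact: mem_set.
    by apply: TP p0; exact: SLG Sy.
  - move=> y a b /set_mem ay /set_mem yb; apply: contrapT => ab.
    by rewrite -[False]/(set0 y) -(Sdisj _ _ ab).
have LS a : Lambda a `<=` Lambda a `|` Gamma a by move=> y; left.
have GS a : Gamma a `<=` Lambda a `|` Gamma a by move=> y; right.
have LD y : msupport mu y -> phi (x - y) != 0 -> y \in D.
  by move=> my p0; rewrite DP mem_set//; left.
have GD y : msupport nu y -> phi (x - y) != 0 -> y \in D.
  by move=> ny p0; rewrite DP mem_set//; right.
rewrite (sum_blocks mu Lambda mu_discrete Lambda_cover LS Lambda_disjoint LD).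
rewrite (sum_blocks nu Gamma nu_discrete Gamma_cover GS Gamma_disjoint GD).
rewrite -sumrB; apply: le_lt_trans (normc_sum _ _ _) _.
apply: (@le_lt_trans _ _ (\sum_(a <- T) e / N.+1%:R)).
  by apply: ler_sum => a _; apply/ltW/block_small.
rewrite big_const_seq count_predT iter_addr_0 -[X in X < _]mulr_natr mulrAC.
by rewrite ltr_pdivrMr// ltr_pM2l// ltr_nat ltnS.
Qed.

End Comparison.

Section Equality.
Context {R : realType} {G : topologicalZmodType}.
Hypothesis G_hausdorff : hausdorff_space G.

(** The two supports may differ a priori, so both sums over atoms are extended to
    their union. *)
Lemma radon_eq_atoms (mu nu : radon_measure R G) :
  discrete_measure mu -> discrete_measure nu ->
  (forall x, mu [set x] = nu [set x]) ->
  forall B, rc_borel B -> mu B = nu B.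
Proof.
move=> md nd atoms B rB; rewrite !radon_atomic//.
transitivity (\sum_(x \in B `&` (msupport mu `|` msupport nu)) mu [set x]).
  apply: fsbig_widen => [x [Bx mx]|x [[Bx _] nx]] /=; first by split=> //; left.
  by apply: radon_atom0 => // mx; apply: nx.
transitivity (\sum_(x \in B `&` (msupport mu `|` msupport nu)) nu [set x]).
  by apply: eq_fsbigr.
apply/esym/fsbig_widen => [x [Bx mx]|x [[Bx _] nx]] /=; first by split=> //; right.
by apply: radon_atom0 => // mx; apply: nx.
Qed.

Hypothesis G_locally_compact : locally_compact [set: G].

Lemma isolating_nbhs (mu : radon_measure R G) (x : G) : discrete_measure mu ->
  nbhs 0 [set w | msupport mu (x - w) -> w = 0].
Proof.
move=> md; have [C Cx cC] := compact_nbhs G_locally_compact x.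
have fF := finite_setD [set x] (msupport_finite md cC).
have : nbhs x (C `&` ~` ((C `&` msupport mu) `\` [set x])).
  apply: filterI => //; apply: open_nbhs_nbhs; split; last by case=> _; exact.
  by apply: closed_openC; apply: compact_closed => //; exact: finite_compact.
have := @continuous_reflect _ x 0; rewrite /continuous_at subr0 => cx /cx h.
apply: (@filterS _ (nbhs (0 : G)) _ _ _ _ h) => w [Cw nF] mw.
apply: contrapT => w0; apply: nF; split=> // xw.
by apply: w0; apply: oppr_inj; apply: (addrI x); rewrite xw oppr0 addr0.
Qed.

Lemma convolution_isolated (mu : radon_measure R G) (phi : G -> R) (C : set G)
    (x : G) : discrete_measure mu -> continuous phi -> compact C ->
  (forall y, 0 <= phi y) -> (forall y, phi y != 0 -> C y) -> phi 0 = 1 ->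
  (forall w, phi w != 0 -> msupport mu (x - w) -> w = 0) ->
  convolution (fun z => (phi z)%:C%C) mu x = mu [set x].
Proof.
move=> md cphi cC phi0 phiC phi1 iso.
rewrite (convolution_atoms G_hausdorff md x cC)//; last first.
  by move=> y nCy; apply/eqP/negP => /negP/phiC.
rewrite (@atom_conv_seq _ _ G_hausdorff _ _ _ _ [:: x])//.
  by rewrite big_mkcond big_seq1 in_setT subrr phi1 mul1r.
move=> y _ my p0; rewrite inE eq_sym -subr_eq0.
by apply/eqP; apply: iso => //; rewrite subKr.
Qed.

End Equality.

Theorem theorem3 (R : realType) (G : topologicalZmodType)
    (G_hausdorff : hausdorff_space G)
    (G_locally_compact : locally_compact [set: G])
    (G_second_countable : @second_countable G)
    (G_sigma_compact : sigma_compact G)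
    (G_not_compact : ~ compact [set: G])
    (mu nu : radon_measure R G)
    (mu_discrete : discrete_measure mu)
    (nu_discrete : discrete_measure nu)
    (mu_almost_periodic : almost_periodic mu)
    (nu_almost_periodic : almost_periodic nu)
    (mu_translation_bounded : translation_bounded mu)
    (nu_translation_bounded : translation_bounded nu)
    (A : Type) (Lambda Gamma : A -> set G)
    (Lambda_cover : msupport mu = \bigcup_a Lambda a)
    (Gamma_cover : msupport nu = \bigcup_a Gamma a)
    (Lambda_disjoint : forall a b, a <> b -> Lambda a `&` Lambda b = set0)
    (Gamma_disjoint : forall a b, a <> b -> Gamma a `&` Gamma b = set0)
    (Lambda_summable : forall a, abs_summable mu (Lambda a))
    (Gamma_summable : forall a, abs_summable nu (Gamma a))
    (H1 : exists2 U : set G, nbhs (0 : G) U &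
       exists N : nat, forall x : G,
         ([set a | ([set x + u | u in U] `&` (Lambda a `|` Gamma a)) !=set0]
            #<= `I_N)%card)
    (H2 : forall (V : set G) (e : R), nbhs (0 : G) V -> 0 < e ->
       exists2 K : set G, compact K &
         forall a, (Lambda a `|` Gamma a) `&` K = set0 ->
           (forall x, (Lambda a `|` Gamma a) x ->
              Lambda a `|` Gamma a `<=` [set x + v | v in V]) /\
           normc (mass mu (Lambda a) - mass nu (Gamma a)) < e) :
  forall B : set G, rc_borel B -> mu B = nu B.
Proof.
have [U U0 [N UN]] := H1.
apply: radon_eq_atoms => // x.
(* The sign turns [x - supp phi] into a part of [x + U]; the other two conditions
   leave [x] as the only atom seen by [phi (x - _)]. *)
pose W := [set w | U (- w)] `&` ([set w | msupport mu (x - w) -> w = 0] `&`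
  [set w | msupport nu (x - w) -> w = 0]).
have W0 : nbhs 0 W.
  by apply: filterI; [exact: nbhs_opp0|apply: filterI; exact: isolating_nbhs].
have [phi [C [cphi cC phi01 phi1 phiCW]]] :=
  @bump R G G_hausdorff G_locally_compact W W0.
have phi_ge0 y : 0 <= phi y by case/andP: (phi01 y).
have phiC y : phi y != 0 -> C y by case/phiCW.
have phiCU y : phi y != 0 -> C y /\ U (- y) by case/phiCW => Cy [].
have phi_Cc : Cc (fun y => (phi y)%:C%C) by exact: bump_Cc cC phiC.
have conv_eq : convolution (fun y => (phi y)%:C%C) mu =
    convolution (fun y => (phi y)%:C%C) nu.
  apply: almost_periodic_eq => //.
  - exact: mu_almost_periodic.
  - exact: nu_almost_periodic.
  - move=> e e0.
    (* Regrouping sums by blocks needs a choice structure on the index type. *)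
    have [K cK Ke] := @convolution_difference_at_infinity R G G_hausdorff
      G_locally_compact G_not_compact mu nu mu_discrete nu_discrete
      mu_translation_bounded nu_translation_bounded {classic A} Lambda Gamma
      Lambda_cover Gamma_cover Lambda_disjoint Gamma_disjoint Lambda_summable
      Gamma_summable U N U0 UN H2 phi C cphi cC phi01 phiCU e e0.
    by exists K.
have iso_mu w : phi w != 0 -> msupport mu (x - w) -> w = 0.
  by case/phiCW => _ [_ []].
have iso_nu w : phi w != 0 -> msupport nu (x - w) -> w = 0.
  by case/phiCW => _ [_ []].
rewrite -(convolution_isolated G_hausdorff mu_discrete cphi cC phi_ge0 phiC phi1 iso_mu).
rewrite -(convolution_isolated G_hausdorff nu_discrete cphi cC phi_ge0 phiC phi1 iso_nu).
by rewrite conv_eq.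
Qed.
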